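(* Let $\mathbb{F}_q$ be a finite field with $q$ elements of odd characteristic, and let $\mathbb{S}^2_\times=\{\boldsymbol{\xi}\in\mathbb{F}_q^3:\xi_1^2+\xi_2^2+\xi_3^2=0\}\setminus\{\boldsymbol{0}\}$, equipped with its normalized counting measure $\sigma$. Then for every function $f:\mathbb{S}^2_\times\to\mathbb{C}$, $$\|(f\sigma)^{\vee}\|^4_{L^4(\mathbb{F}_q^3,d\boldsymbol{x})}\leq \frac{q^3}{|\mathbb{S}^2_\times|^2}\left(q+1-\frac{3q-4}{|\mathbb{S}^2_\times|}\right)\|f\|^4_{L^2(\mathbb{S}^2_\times,d\sigma)}.$$ This inequality is sharp (the constant on the right-hand side cannot be replaced by a smaller one), and equality holds if $f$ is a constant function. Moreover, any maximizer $f$ of this inequality has constant modulus, i.e. $|f|$ is constant on $\mathbb{S}^2_\times$.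
   Context: Fix a non-principal (nontrivial) additive character $\chi:\mathbb{F}_q\to\{z\in\mathbb{C}:|z|=1\}$. For a nonempty finite set $\mathcal{S}\subset\mathbb{F}_q^3$ and $f:\mathcal{S}\to\mathbb{C}$, define for $\boldsymbol{x}\in\mathbb{F}_q^3$ $$(f\sigma)^\vee(\boldsymbol{x})=\frac{1}{|\mathcal{S}|}\sum_{\boldsymbol{\xi}\in\mathcal{S}}f(\boldsymbol{\xi})\chi(\boldsymbol{\xi}\cdot\boldsymbol{x}),\qquad \boldsymbol{\xi}\cdot\boldsymbol{x}=\xi_1x_1+\xi_2x_2+\xi_3x_3.$$ Norms: $d\boldsymbol{x}$ is counting measure, so $\|g\|_{L^4(\mathbb{F}_q^3,d\boldsymbol{x})}^4=\sum_{\boldsymbol{x}\in\mathbb{F}_q^3}|g(\boldsymbol{x})|^4$; $\sigma$ is normalized counting measure on $\mathcal{S}$, so $\|f\|_{L^2(\mathcal{S},d\sigma)}^2=\frac{1}{|\mathcal{S}|}\sum_{\boldsymbol{\xi}\in\mathcal{S}}|f(\boldsymbol{\xi})|^2$. $|\cdot|$ of a set denotes cardinality. A maximizer is a nonzero function $f$ for which equality holds. *)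

(* Defs.v *)
From HB Require Import structures.
From mathcomp Require Import all_boot all_order all_algebra.
From mathcomp Require Import reals exp.
From mathcomp Require Import complex.

Set Implicit Arguments.
Unset Strict Implicit.
Unset Printing Implicit Defensive.

Import Order.TTheory GRing.Theory Num.Theory.
Import ComplexField.Normc.
Local Open Scope ring_scope.
Local Open Scope complex_scope.

(* The field of complex numbers is [R[i]] for [R : realType]; its modulus is
   taken in [R], as [normc], since the norm [`|z|] has values in [R[i]]. *)

Definition nontrivial_additive_character (R : realType) (F : finFieldType)
    (chi : F -> R[i]) : Prop :=
  [/\ forall a, normc (chi a) = 1,
      forall a b, chi (a + b) = chi a * chi b
    & exists a, chi a <> 1].

Definition dot (F : finFieldType) (n : nat) (xi x : 'rV[F]_n) : F :=
  \sum_(i < n) xi 0 i * x 0 i.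

Definition extension (R : realType) (F : finFieldType) (n : nat)
    (chi : F -> R[i]) (S : {set 'rV[F]_n}) (f : {xi | xi \in S} -> R[i])
    (x : 'rV[F]_n) : R[i] :=
  (#|S|%:R)^-1 * \sum_(xi : {xi | xi \in S}) f xi * chi (dot (val xi) x).

Definition L4norm (R : realType) (F : finFieldType) (n : nat)
    (g : 'rV[F]_n -> R[i]) : R :=
  (\sum_(x : 'rV[F]_n) normc (g x) ^+ 4) `^ (4%:R^-1).

Definition L2norm (R : realType) (F : finFieldType) (n : nat)
    (S : {set 'rV[F]_n}) (f : {xi | xi \in S} -> R[i]) : R :=
  Num.sqrt ((#|S|%:R)^-1 * \sum_(xi : {xi | xi \in S}) normc (f xi) ^+ 2).

Definition cone (F : finFieldType) : {set 'rV[F]_3} :=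
  [set xi : 'rV[F]_3 | \sum_(i < 3) xi 0 i ^+ 2 == 0] :\ 0.

Definition cone_constant (R : realType) (F : finFieldType) : R :=
  let q : R := #|F|%:R in
  let s : R := #|cone F|%:R in
  q ^+ 3 / s ^+ 2 * (q + 1 - (3 * q - 4) / s).

Definition maximizer (R : realType) (F : finFieldType) (chi : F -> R[i])
    (f : {xi | xi \in cone F} -> R[i]) : Prop :=
  (exists xi, f xi <> 0) /\
  L4norm (extension chi f) ^+ 4 = cone_constant R F * L2norm f ^+ 4.

(* Main.v *)
(* By Parseval, the fourth power of the L^4 norm is q^3/|S|^4 times the sum of
   |f*f|^2, which is at most the additive energy of g = |f|. Write u = g^2,
   U = sum u, Y = sum g(a)g(-a), Z = sum (g(a)g(-a))^2 and let T be the sum of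
   u(a)u(b) over collinear pairs, i.e. pairs with a.b = 0. Quadruples
   a + b = c + d in S are of three kinds:
   - a + b = 0: they contribute exactly Y^2;
   - a.b = 0 and a + b <> 0: all four points are on one line, each pair has
     q - 2 partners, and AM-GM bounds their contribution by (q - 2)(T - Z);
   - a.b <> 0: {c,d} = {a,b}, or else a.c and a.d are nonzero too. In the last
     case the number of partners of (a,b) depends on the quadratic character of
     -2a.b; spreading AM-GM over the three pairings of the quadruple, with
     weights depending on the quadratic characters, makes the kernel constant.
     The total is at most q(U^2 - T).
   The bound follows from |S|T >= (q - 1)U^2, |S|Z >= Y^2 and Y <= U, and
   equality in the last two forces g to be constant on S. *)

Require Import Defs.
From mathcomp Require Import all_boot all_order all_algebra.
From mathcomp Require Import reals exp.
From mathcomp Require Import complex.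
From mathcomp Require Import ring lra.
Import Order.TTheory GRing.Theory Num.Theory.
Import ComplexField.Normc.
Local Open Scope ring_scope.
Local Open Scope complex_scope.

(** * The quadratic character *)

Section QuadraticCharacter.

Context {R : realFieldType} {F : finFieldType}.
Implicit Types a b c k y : F.

Definition nsqrt c : R := #|[set z : F | z ^+ 2 == c]|%:R.

(** In odd characteristic this is the quadratic character. Root counts give it values directly in
    [R] and turn its sums over [c] into counts of field elements. *)
Definition qchar c : R := nsqrt c - 1.

Lemma nsqrtE c : nsqrt c = 1 + qchar c.
Proof. by rewrite /qchar addrCA subrr addr0. Qed.

Lemma nsqrt_sum c : nsqrt c = \sum_(z : F | z ^+ 2 == c) 1.
Proof. by rewrite sumr_const /nsqrt cardsE. Qed.

Lemma nsqrt0 : nsqrt 0 = 1.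
Proof.
rewrite /nsqrt (_ : [set z : F | z ^+ 2 == 0] = [set 0]) ?cards1 //.
by apply/setP => z; rewrite !inE sqrf_eq0.
Qed.

Lemma qchar0 : qchar 0 = 0.
Proof. by rewrite /qchar nsqrt0 subrr. Qed.

Lemma sum_qchar : \sum_c qchar c = 0.
Proof.
rewrite /qchar sumrB.
under eq_bigr do rewrite nsqrt_sum.
rewrite (exchange_big_dep xpredT) //= -sumrB big1 // => z _.
rewrite (big_pred1 (z ^+ 2)) ?subrr // => c; exact: eq_sym.
Qed.

Lemma nsqrtM2 k c : k != 0 -> nsqrt (k ^+ 2 * c) = nsqrt c.
Proof.
move=> k0; rewrite /nsqrt; congr (_%:R).
rewrite -[RHS](card_imset _ (mulfI k0)); congr #|pred_of_set _|.
apply/setP => z; apply/idP/imsetP; rewrite ?inE.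
  move=> /eqP zE; exists (z / k); last by rewrite mulrC divfK.
  by rewrite inE expr_div_n zE mulrC mulKf // expf_neq0.
by move=> [w]; rewrite inE => /eqP <- ->; rewrite exprMn.
Qed.

Lemma qcharM2 k c : k != 0 -> qchar (k ^+ 2 * c) = qchar c.
Proof. by move=> k0; rewrite /qchar nsqrtM2. Qed.

Lemma sum_qcharM k : k != 0 -> \sum_c qchar (k * c) = 0.
Proof.
by move=> k0; rewrite -[RHS]sum_qchar [RHS](reindex_inj (mulfI k0)).
Qed.

Hypothesis odd_char : (2 : F) != 0.

Lemma qchar_sqr k : k != 0 -> qchar (k ^+ 2) = 1.
Proof.
move=> k0; rewrite -[k ^+ 2]mulr1 qcharM2 // /qchar /nsqrt.
rewrite (_ : [set z : F | z ^+ 2 == 1] = [set 1; -1]); last first.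
  by apply/setP => z; rewrite !inE sqrf_eq1.
have n1 : 1 != -1 :> F by rewrite -subr_eq0 opprK.
by rewrite cards2 n1 mulr2n addrK.
Qed.

Lemma qchar1 : qchar 1 = 1.
Proof. by rewrite -(expr1n _ 2) qchar_sqr // oner_neq0. Qed.

Lemma qcharP c : c != 0 ->
  qchar c = -1 \/ exists2 k, k != 0 & c = k ^+ 2.
Proof.
move=> c0; case: (set_0Vmem [set z : F | z ^+ 2 == c]) => [E|[z]].
  by left; rewrite /qchar /nsqrt E cards0 sub0r.
rewrite inE => /eqP zc; right; exists z => //.
by apply: contraNneq c0 => z0; rewrite -zc z0 expr0n.
Qed.

Lemma qchar_pm1 c : c != 0 -> qchar c = 1 \/ qchar c = -1.
Proof. by case/qcharP => [|[k k0 ->]]; [right|left; apply: qchar_sqr]. Qed.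

Lemma qchar_ge c : -1 <= qchar c.
Proof. by rewrite /qchar lerBrDr addNr ler0n. Qed.

Lemma qchar_le1 c : qchar c <= 1.
Proof.
have [->|/qchar_pm1[]->//] := eqVneq c 0; first by rewrite qchar0 ler01.
by lra.
Qed.

(* For a nonsquare [a], [qchar (a * b) + qchar b] is nonpositive for every [b],
   and it sums to zero over [b]. *)
Lemma qcharM a b : qchar (a * b) = qchar a * qchar b.
Proof.
have [->|a0] := eqVneq a 0; first by rewrite mul0r qchar0 mul0r.
case: (qcharP _ a0) => [a1|[k k0 ->]]; last by rewrite qcharM2 // qchar_sqr // mul1r.
rewrite a1 mulN1r; apply/eqP; rewrite -addr_eq0; apply/eqP.
have le0 c : 0 <= - (qchar (a * c) + qchar c).
  have [->|c0] := eqVneq c 0; first by rewrite mulr0 qchar0 addr0 oppr0.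
  case: (qcharP _ c0) => [->|[k k0 ->]].
    by have := qchar_le1 (a * c); lra.
  by rewrite mulrC qcharM2 // qchar_sqr // a1; lra.
have /eqP : \sum_c - (qchar (a * c) + qchar c) = 0.
  by rewrite sumrN big_split /= sum_qcharM // sum_qchar addr0 oppr0.
rewrite psumr_eq0 => [/allP/(_ b)|c _]; last exact: le0.
by rewrite mem_index_enum oppr_eq0 => /(_ isT)/eqP.
Qed.

(** With [y = 1 / (1 + u)] one has [y (1 - y) = y^2 u], so the summand becomes [1 + qchar (k u)].
    Over all [u] this sums to q; the excluded [u = -1] and [u = 0] account for [1 + qchar (- k)] and
    1. *)
Lemma sum_nsqrt k : k != 0 ->
  \sum_(y | (y != 0) && (y != 1)) nsqrt (k * (y * (1 - y)))
    = #|F|%:R - 2 - qchar (- k).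
Proof.
move=> k0; pose h y : F := (1 + y)^-1.
have hK y : (y != 0) && (y != 1) -> h (y^-1 - 1) = y.
  by move=> _; rewrite /h addrC subrK invrK.
rewrite (reindex_onto h (fun y => y^-1 - 1) hK).
have E y : ((h y != 0) && (h y != 1)) && ((h y)^-1 - 1 == y) =
   (y != -1) && (y != 0).
  rewrite /h invrK [1 + y]addrC addrK eqxx andbT invr_eq0 invr_eq1 addr_eq0.
  by rewrite -[y + 1 == 1]subr_eq0 addrK.
rewrite (eq_bigl _ _ E).
have V y : (y != -1) && (y != 0) ->
    nsqrt (k * (h y * (1 - h y))) = 1 + qchar (k * y).
  move=> /andP[y1 y0]; rewrite nsqrtE; congr (_ + _).
  have y1' : 1 + y != 0 by rewrite addrC addr_eq0.
  rewrite -(qcharM2 (h y) (k * y)) ?invr_eq0 //; congr qchar.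
  by rewrite /h; field.
rewrite (eq_bigr _ V).
have : \sum_y (1 + qchar (k * y)) = #|F|%:R.
  by rewrite big_split /= sum_qcharM // addr0 sumr_const.
rewrite (bigD1 (-1)) //= (bigD1 0) /=; last by rewrite eq_sym oppr_eq0 oner_neq0.
rewrite mulr0 qchar0 mulrN1 => <-; ring.
Qed.

(** Since [k y (1 - y) * k y = (k y)^2 (1 - y)], multiplicativity turns the summand into
    [qchar (k y) + qchar (1 - y)]. Both terms sum to 0 over the field, and the excluded [y = 0] and
    [y = 1] contribute 1 and [qchar k]. *)
Lemma sum_nsqrt_qchar k : k != 0 ->
  \sum_(y | (y != 0) && (y != 1)) nsqrt (k * (y * (1 - y))) * qchar (k * y)
    = - 1 - qchar k.
Proof.
move=> k0.
have V y : (y != 0) && (y != 1) ->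
    nsqrt (k * (y * (1 - y))) * qchar (k * y) = qchar (k * y) + qchar (1 - y).
  move=> /andP[y0 _]; rewrite nsqrtE mulrDl mul1r -qcharM; congr (_ + _).
  by rewrite -(qcharM2 (k * y) (1 - y)) ?mulf_neq0 //; congr qchar; ring.
rewrite (eq_bigr _ V).
have : \sum_y (qchar (k * y) + qchar (1 - y)) = 0.
  rewrite big_split /= sum_qcharM // add0r.
  by rewrite -[RHS]sum_qchar [RHS](reindex_inj (subrI 1)).
rewrite (bigD1 0) //= (bigD1 1) /=; last exact: oner_neq0.
by rewrite mulr0 qchar0 subr0 qchar1 mulr1 subrr qchar0 => /eqP; lra.
Qed.

Lemma sum_nsqrt_qcharC k : k != 0 ->
  \sum_(y | (y != 0) && (y != 1))
     nsqrt (k * (y * (1 - y))) * qchar (k * (1 - y)) = - 1 - qchar k.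
Proof.
move=> k0; rewrite -sum_nsqrt_qchar // (reindex_inj (subrI 1)) /=.
apply: eq_big => [y|y _].
  by rewrite -[1 - y == 1]subr_eq0 addrAC subrr sub0r oppr_eq0 subr_eq0
    andbC [1 == y]eq_sym.
by rewrite subKr [y * _]mulrC.
Qed.

End QuadraticCharacter.

(** * Isotropic vectors of the ternary form *)

Section Dot.

Context {F : finFieldType} {n : nat}.
Implicit Types a b c : 'rV[F]_n.

Lemma dotC a b : dot a b = dot b a.
Proof. by apply: eq_bigr => i _; rewrite mulrC. Qed.

Lemma dotDl a b c : dot (a + b) c = dot a c + dot b c.
Proof. by rewrite -big_split; apply: eq_bigr => i _; rewrite mxE mulrDl. Qed.

Lemma dotDr a b c : dot a (b + c) = dot a b + dot a c.
Proof. by rewrite dotC dotDl !(dotC a). Qed.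

Lemma dotZl t a b : dot (t *: a) b = t * dot a b.
Proof. by rewrite /dot mulr_sumr; apply: eq_bigr => i _; rewrite mxE mulrA. Qed.

Lemma dotZr t a b : dot a (t *: b) = t * dot a b.
Proof. by rewrite dotC dotZl dotC. Qed.

Lemma dotNl a b : dot (- a) b = - dot a b.
Proof. by rewrite -scaleN1r dotZl mulN1r. Qed.

Lemma dotNr a b : dot a (- b) = - dot a b.
Proof. by rewrite dotC dotNl dotC. Qed.

Lemma dot0l a : dot 0 a = 0.
Proof. by rewrite -(scale0r a) dotZl mul0r. Qed.

Lemma dot0r a : dot a 0 = 0.
Proof. by rewrite dotC dot0l. Qed.

Lemma row_neq0 a : a != 0 -> exists i, a 0 i != 0.
Proof.
move=> a0; apply/existsP; apply: contraNT a0.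
rewrite negb_exists => /forallP a0; apply/eqP/rowP => i.
by rewrite mxE; apply/eqP; rewrite -[_ == _]negbK.
Qed.

Lemma scalel_inj a : a != 0 -> injective (fun t : F => t *: a).
Proof.
move=> a0 s t /eqP; rewrite -subr_eq0 -scalerBl scaler_eq0 (negPf a0) orbF.
by rewrite subr_eq0 => /eqP.
Qed.

End Dot.

Section Cone.

Context {F : finFieldType}.
Implicit Types (a b c d p : 'rV[F]_3) (t m y z : F).

Lemma ord3P (i : 'I_3) : [\/ i = 0, i = 1 | i = 2%:R].
Proof.
by case: i => -[|[|[|//]]] i3; [apply: Or31|apply: Or32|apply: Or33];
  apply: val_inj.
Qed.

Lemma row3P a b : [/\ a 0 0 = b 0 0, a 0 1 = b 0 1 & a 0 2%:R = b 0 2%:R] ->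
  a = b.
Proof. by move=> [e0 e1 e2]; apply/rowP => i; case: (ord3P i) => ->. Qed.

Lemma dot3E a b :
  dot a b = a 0 0 * b 0 0 + a 0 1 * b 0 1 + a 0 2%:R * b 0 2%:R.
Proof.
rewrite /dot !big_ord_recl big_ord0 addr0 addrA.
by congr (_ + _ * _ + _ * _); congr (fun_of_matrix _ 0 _); apply: val_inj.
Qed.

Definition cross a b : 'rV[F]_3 :=
  \row_i [:: a 0 1 * b 0 2%:R - a 0 2%:R * b 0 1;
             a 0 2%:R * b 0 0 - a 0 0 * b 0 2%:R;
             a 0 0 * b 0 1 - a 0 1 * b 0 0]`_i.

Lemma crossC a b : cross a b = - cross b a.
Proof. by apply: row3P; rewrite !mxE /=; split; ring. Qed.

Lemma dot_cross_l a b : dot (cross a b) a = 0.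
Proof. by rewrite dot3E !mxE /=; ring. Qed.

Lemma dot_cross_r a b : dot (cross a b) b = 0.
Proof. by rewrite dot3E !mxE /=; ring. Qed.

Lemma dot_cross a b :
  dot (cross a b) (cross a b) = dot a a * dot b b - dot a b ^+ 2.
Proof. by rewrite !dot3E !mxE /=; ring. Qed.

Lemma cross_crossl a b : cross (cross a b) a = dot a a *: b - dot a b *: a.
Proof. by apply: row3P; rewrite !mxE /= !dot3E; split; ring. Qed.

Lemma cross_crossr a b : cross (cross a b) b = dot a b *: b - dot b b *: a.
Proof. by apply: row3P; rewrite !mxE /= !dot3E; split; ring. Qed.

(** Up to the factor [dot w w], the determinant of [a, b, w], the vectors [cross b w], [cross w a]
    and [w] form the basis dual to [a, b, w]. *)
Lemma cross_basis a b c : let w := cross a b in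
  dot w w *: c =
  dot c a *: cross b w + dot c b *: cross w a + dot c w *: w.
Proof. by move=> w; apply: row3P; rewrite !mxE /= !dot3E !mxE /=; split; ring. Qed.

Lemma cross_eq0 a b : b != 0 -> cross a b = 0 -> exists t, a = t *: b.
Proof.
move=> /row_neq0[j bj0] ab; exists (a 0 j / b 0 j).
have E (i : 'I_3) := congr1 (fun v : 'rV[F]_3 => v 0 i) ab.
have := E 2%:R; have := E 1; have := E 0; rewrite !mxE /= => E0 E1 E2.
suff E3 : b 0 j *: a = a 0 j *: b.
  by rewrite mulrC -scalerA -E3 scalerA mulVf // scale1r.
have {}E0 : a 0 1 * b 0 2%:R = a 0 2%:R * b 0 1 by apply/eqP; rewrite -subr_eq0 E0.
have {}E1 : a 0 2%:R * b 0 0 = a 0 0 * b 0 2%:R by apply/eqP; rewrite -subr_eq0 E1.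
have {}E2 : a 0 0 * b 0 1 = a 0 1 * b 0 0 by apply/eqP; rewrite -subr_eq0 E2.
by case: (ord3P j) => ->; apply: row3P; rewrite !mxE !(mulrC (b 0 _)); split.
Qed.

Lemma coneE a : (a \in cone F) = (a != 0) && (dot a a == 0).
Proof.
by rewrite !inE; congr (_ && (_ == _)); apply: eq_bigr => i _; rewrite expr2.
Qed.

Lemma cone_neq0 a : a \in cone F -> a != 0.
Proof. by rewrite coneE => /andP[]. Qed.

Lemma cone_dot a : a \in cone F -> dot a a = 0.
Proof. by rewrite coneE => /andP[_ /eqP]. Qed.

Lemma coneN a : (- a \in cone F) = (a \in cone F).
Proof. by rewrite !coneE oppr_eq0 dotNl dotNr opprK. Qed.

Lemma coneZ t a : t != 0 -> (t *: a \in cone F) = (a \in cone F).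
Proof.
by move=> t0; rewrite !coneE scaler_eq0 dotZl dotZr !mulf_eq0 (negPf t0).
Qed.

(* The ternary form has no totally isotropic plane. *)
Lemma isotropic_orth a b : dot a a = 0 -> dot b b = 0 -> dot a b = 0 ->
  b != 0 -> exists t, a = t *: b.
Proof.
move=> aa bb ab b0; apply: (cross_eq0 _ _ b0); apply/eqP.
apply: contraT => w0.
(* If [w = cross a b] were nonzero, its cross products with [a] and [b] would vanish, making both
   multiples of [w] and hence [w = 0]. *)
have := cross_crossl a b; rewrite aa ab !scale0r subr0 => w1.
have := cross_crossr a b; rewrite bb ab !scale0r subr0 => w2.
have N p q : cross p q = 0 -> cross q p = 0.
  by rewrite crossC => /eqP; rewrite oppr_eq0 => /eqP.
have [s as_] := cross_eq0 _ _ w0 (N _ _ w1).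
have [t bt] := cross_eq0 _ _ w0 (N _ _ w2).
have : cross (s *: cross a b) (t *: cross a b) = 0.
  by apply: row3P; rewrite !mxE /=; split; ring.
by rewrite -as_ -bt => w; case/eqP: w0.
Qed.

(** * Points completing a pair of isotropic vectors to an additive quadruple *)

Section Fiber.

Context {R : realFieldType}.
Variables (a b : 'rV[F]_3).
Hypotheses (odd_char : (2 : F) != 0).
Hypotheses (aa : dot a a = 0) (bb : dot b b = 0) (ab : dot a b != 0).

Let m := dot a b.

(* The points [c] with [c] and [a + b - c] isotropic are the
   [(1 - y) a + y b + (z / m) (a x b)] with [z ^ 2 = 2 m y (1 - y)]. *)
Lemma sum_fiber (G : F -> R) :
  \sum_(c | [&& c \in cone F, a + b - c \in cone F, dot a c != 0
               & dot a (a + b - c) != 0]) G (dot a c)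
  = \sum_(y | (y != 0) && (y != 1)) nsqrt (2 * m * (y * (1 - y))) * G (m * y).
Proof.
pose w := cross a b.
have ww : dot w w = - m ^+ 2 by rewrite dot_cross aa bb mul0r sub0r.
have aw : dot a w = 0 by rewrite dotC dot_cross_l.
have bw : dot b w = 0 by rewrite dotC dot_cross_r.
have m0 : m != 0 := ab.
pose h (p : F * F) := (1 - p.1) *: a + p.1 *: b + (p.2 / m) *: w.
pose h' c := (dot a c / m, - dot c w / m).
have ha (p : F * F) : dot a (h p) = m * p.1.
  by rewrite !dotDr !dotZr aa aw -/m; ring.
have hb (p : F * F) : dot b (h p) = m * (1 - p.1).
  by rewrite !dotDr !dotZr bb bw [dot b a]dotC -/m; ring.
have hw (p : F * F) : dot (h p) w = - (p.2 * m).
  by rewrite !dotDl !dotZl aw bw ww; field.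
have hK (p : F * F) : h' (h p) = p.
  rewrite /h' ha hw opprK mulrC mulKf // mulfK //; exact: esym (surjective_pairing p).
have h'K c : dot c c = 0 -> dot (a + b - c) (a + b - c) = 0 -> h (h' c) = c.
  move=> cc dd.
  (* Isotropy of [a + b - c] leaves [2 (m - a.c - b.c) = 0]; odd characteristic removes the 2. *)
  have abc : dot a c + dot b c = m.
    move: dd; rewrite !(dotDl, dotDr, dotNl, dotNr) aa bb cc.
    rewrite ![dot c _]dotC [dot b a]dotC -/m => dd.
    have /(mulfI odd_char)// : 2 * (dot a c + dot b c) = 2 * m.
    by apply/eqP; rewrite -subr_eq0 -oppr_eq0 -dd; apply/eqP; ring.
  have bc : dot b c = m - dot a c by rewrite -abc; ring.
  have := cross_basis a b c; rewrite /= (crossC b) cross_crossl cross_crossr.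
  rewrite -/w ww aa bb -/m !scale0r subr0 sub0r ![dot c _]dotC bc => E.
  have m2 : - m ^+ 2 != 0 by rewrite oppr_eq0 expf_neq0.
  apply: (scalerI m2); rewrite E /h /h' /= [dot c w]dotC.
  by apply/rowP => i; rewrite !mxE; field.
(* Opening [nsqrt] as a sum over the roots [z] gives a sum over pairs [(y, z)], which [h] matches
   with the points [c]. *)
under [RHS]eq_bigr do rewrite nsqrt_sum mulr_suml.
rewrite pair_big_dep /=.
have h'KP c : [&& c \in cone F, a + b - c \in cone F, dot a c != 0
               & dot a (a + b - c) != 0] -> h (h' c) = c.
  by move=> /and4P[/cone_dot cc /cone_dot dd _ _]; apply: h'K.
rewrite (reindex_onto h h' h'KP).
apply: eq_big => [p|p _]; last by rewrite ha mul1r.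
rewrite hK eqxx andbT !coneE ha.
have hh : dot (h p) (h p) = 2 * m * (p.1 * (1 - p.1)) - p.2 ^+ 2.
  rewrite !(dotDl, dotDr, dotZl, dotZr) aa bb aw bw ww [dot b a]dotC.
  by rewrite [dot w a]dotC [dot w b]dotC aw bw -/m; field.
have dd : dot (a + b - h p) (a + b - h p) = dot (h p) (h p).
  move: (h p) (ha p) (hb p) => c ca cb.
  rewrite !(dotDl, dotDr, dotNl, dotNr) aa bb [dot c a]dotC [dot c b]dotC.
  by rewrite [dot b a]dotC ca cb -/m; ring.
have ad : dot a (a + b - h p) = m * (1 - p.1).
  by move: (h p) (ha p) => c ca; rewrite !(dotDr, dotNr) aa ca -/m; ring.
rewrite ad dd hh !mulf_eq0 (negPf m0) /= [1 - p.1 == 0]subr_eq0 subr_eq0.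
rewrite [_ == p.2 ^+ 2]eq_sym [1 == _]eq_sym.
case: (eqVneq p.1 0) => [|p0] /=; first by rewrite !andbF.
case: (eqVneq p.1 1) => [|p1] /=; first by rewrite ?andbF.
case: (p.2 ^+ 2 =P _) => [E|]; last by rewrite !andbF.
(* Neither point is 0, because its product with [a] is [m y] or [m (1 - y)]. *)
rewrite !andbT; apply/andP; split.
  by apply: contraNneq p0 => h0; move: (ha p); rewrite h0 dot0r => /esym/eqP;
    rewrite mulf_eq0 (negPf m0).
apply: contraNneq p1 => h0; move: ad; rewrite h0 dot0r => /esym/eqP.
by rewrite mulf_eq0 (negPf m0) subr_eq0 eq_sym.
Qed.

End Fiber.

End Cone.

(** * Additive quadruples on the cone *)

Lemma involution_pred {T : Type} (P : pred T) (s : T -> T) :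
  involutive s -> (forall t, P t -> P (s t)) -> forall t, P (s t) = P t.
Proof.
by move=> sK Ps t; apply/idP/idP => [/Ps|]; rewrite ?sK //; apply: Ps.
Qed.

(** AM-GM with its defect kept: the product is half the sum of the two squares minus half the square
    of the difference, and reindexing by [s] identifies the two sums of squares. *)
Lemma sum_involution_amgm {R : realFieldType} {T : finType} (s : T -> T)
    (P : pred T) (w x : T -> R) :
    involutive s -> (forall t, P (s t) = P t) ->
    (forall t, P t -> w (s t) = w t) ->
  \sum_(t | P t) w t * (x t * x (s t)) =
  \sum_(t | P t) w t * x t ^+ 2
    - \sum_(t | P t) w t * (x t - x (s t)) ^+ 2 / 2.
Proof.
move=> sK Ps ws.
have E : \sum_(t | P t) w t * x (s t) ^+ 2 = \sum_(t | P t) w t * x t ^+ 2.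
  rewrite [RHS](reindex_inj (inv_inj sK)) /=.
  by apply: eq_big => // t Pt; rewrite ws.
have -> : \sum_(t | P t) w t * x t ^+ 2 =
    \sum_(t | P t) (w t * x t ^+ 2 + w t * x (s t) ^+ 2) / 2.
  by rewrite -mulr_suml big_split /= E; field.
by rewrite -sumrB; apply: eq_bigr => t _; field.
Qed.

Section Energy.

Context {R : realFieldType} {F : finFieldType}.
Hypothesis odd_char : (2 : F) != 0.
Notation V := 'rV[F]_3.
Notation chi := (@qchar R F).
Notation q := (#|F|%:R : R).
Implicit Types (a b c d : V) (p : V * V * V).

(* The triple [(a, b, c)] encodes the additive quadruple
   [a + b = c + (a + b - c)]. *)
Definition nd p := let: (a, b, c) := p in
  [&& a \in cone F, b \in cone F, c \in cone F, a + b - c \in cone F,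
      dot a b != 0, dot a c != 0 & dot a (a + b - c) != 0].

(** Expanding the isotropy of [d = a + b - c] gives [b.c = a.b - a.c]. Thus complementary pairs of a
    quadruple have equal dot products. *)
Lemma cone_quad_dot a b c :
    [/\ a \in cone F, b \in cone F, c \in cone F & a + b - c \in cone F] ->
  [/\ dot c (a + b - c) = dot a b, dot b (a + b - c) = dot a c,
      dot b c = dot a (a + b - c) & dot a (a + b - c) = dot a b - dot a c].
Proof.
move=> [/cone_dot aa /cone_dot bb /cone_dot cc /cone_dot].
rewrite !(dotDl, dotDr, dotNl, dotNr) aa bb cc.
rewrite [dot c a]dotC [dot c b]dotC [dot b a]dotC => dd.
have /(mulfI odd_char) E : 2 * dot b c = 2 * (dot a b - dot a c).
  by apply/eqP; rewrite -subr_eq0 -oppr_eq0 -dd; apply/eqP; ring.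
by split; rewrite ?(cc, bb) ?E; ring.
Qed.

(** Along the fiber over [(a, b)] one has [a.c = m y] and [a.d = m (1 - y)], so the three sums above
    apply with parameter [2 m]. *)
Lemma sum_nd_c (A k : R) a b : a \in cone F -> b \in cone F -> dot a b != 0 ->
  \sum_(c | nd (a, b, c)) (A + k * (chi (2 * dot a c) + chi (2 * dot a (a + b - c))))
  = A * (q - 2 - chi (- (2 * dot a b))) - 2 * k * (1 + chi (2 * dot a b)).
Proof.
move=> aS bS ab; set m := dot a b.
have [aa bb] := (cone_dot _ aS, cone_dot _ bS).
have m2 : 2 * m != 0 by rewrite mulf_neq0.
pose G t := A + k * (chi (2 * t) + chi (2 * (m - t))).
rewrite (eq_bigl (fun c => [&& c \in cone F, a + b - c \in cone F, dot a c != 0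
               & dot a (a + b - c) != 0])); last first.
  by move=> c; rewrite /= aS bS ab /=.
rewrite (eq_bigr (fun c => G (dot a c))); last first.
  move=> c /and4P[cS dS _ _]; rewrite /G.
  by have [_ _ _ ->] := cone_quad_dot _ _ _ (And4 aS bS cS dS).
rewrite sum_fiber //.
have E y : nsqrt (2 * m * (y * (1 - y))) * G (m * y) =
    A * nsqrt (2 * m * (y * (1 - y)))
    + k * (nsqrt (2 * m * (y * (1 - y))) * chi (2 * m * y)
       + nsqrt (2 * m * (y * (1 - y))) * chi (2 * m * (1 - y))) :> R.
  rewrite /G mulrA (_ : 2 * (m - m * y) = 2 * m * (1 - y)); last by ring.
  by ring.
under eq_bigr do rewrite E.
rewrite big_split -!mulr_sumr big_split /= sum_nsqrt // sum_nsqrt_qchar //.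
by rewrite sum_nsqrt_qcharC //; ring.
Qed.

(** The relation [a + b = c + d] reads [a + (- c) = (- b) + d], so this is [sum_nd_c] for the pair
    [(a, - c)]; hence the changed signs. *)
Lemma sum_nd_b (A k : R) a c : a \in cone F -> c \in cone F -> dot a c != 0 ->
  \sum_(b | nd (a, b, c)) (A + k * (chi (- (2 * dot a b)) + chi (2 * dot a (a + b - c))))
  = A * (q - 2 - chi (2 * dot a c)) - 2 * k * (1 + chi (- (2 * dot a c))).
Proof.
move=> aS cS ac; rewrite (reindex_inj oppr_inj) /=.
have cS' : - c \in cone F by rewrite coneN.
have ac' : dot a (- c) != 0 by rewrite dotNr oppr_eq0.
have := sum_nd_c A k a (- c) aS cS' ac'.
rewrite dotNr mulrN opprK => <-; apply: eq_big => [b|b _].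
  rewrite /= aS cS cS' !coneN ac ac' dotNr oppr_eq0 /=.
  rewrite [a - b - c]addrAC; case: (b \in _) => //=.
by rewrite dotNr mulrN opprK [a - b - c]addrAC.
Qed.

Lemma sum_tripleE (P : pred (V * V * V)) (f : V * V * V -> R) :
  \sum_(p | P p) f p = \sum_a \sum_b \sum_(c | P (a, b, c)) f (a, b, c).
Proof.
by rewrite pair_big pair_big_dep /=; apply: eq_big => [[[? ?] ?]|[[? ?] ?]].
Qed.

(** Symmetries of the quadruple with implicit fourth entry [d]: they exchange [(a, b)] with
    [(c, d)], [(a, c)] with [(b, d)], and [c] with [d]. Being involutions, they allow AM-GM along
    the corresponding pairing. *)
Definition swap12_34 p : V * V * V := (p.2, p.1.1 + p.1.2 - p.2, p.1.1).
Definition swap13_24 p : V * V * V := (p.1.2, p.1.1, p.1.1 + p.1.2 - p.2).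
Definition swap34 p : V * V * V := (p.1.1, p.1.2, p.1.1 + p.1.2 - p.2).

Lemma swap12_34K : involutive swap12_34.
Proof. by move=> [[a b] c]; rewrite /swap12_34 /= [c + _]addrC subrK addrAC subrr add0r. Qed.

Lemma swap13_24K : involutive swap13_24.
Proof. by move=> [[a b] c]; rewrite /swap13_24 /= [b + a]addrC subKr. Qed.

Lemma swap34K : involutive swap34.
Proof. by move=> [[a b] c]; rewrite /swap34 /= subKr. Qed.

Lemma nd_swap34 p : nd (swap34 p) = nd p.
Proof.
apply: (involution_pred nd _ swap34K) => -[[a b] c] /and5P[aS bS cS dS /and3P[ab ac ad]].
by rewrite /nd /swap34 /= subKr aS bS cS dS ab ac ad.
Qed.

Lemma nd_swap12_34 p : nd (swap12_34 p) = nd p.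
Proof.
apply: (involution_pred nd _ swap12_34K) => -[[a b] c] /and5P[aS bS cS dS /and3P[ab ac ad]].
have [cd bd bc _] := cone_quad_dot _ _ _ (And4 aS bS cS dS).
have dE : c + (a + b - c) - a = b by rewrite [c + _]addrC subrK addrAC subrr add0r.
rewrite /nd /swap12_34 /= dE.
by rewrite aS bS cS dS cd [dot c b]dotC bc [dot c a]dotC ab ac ad.
Qed.

Lemma nd_swap13_24 p : nd (swap13_24 p) = nd p.
Proof.
apply: (involution_pred nd _ swap13_24K) => -[[a b] c] /and5P[aS bS cS dS /and3P[ab ac ad]].
have [cd bd bc _] := cone_quad_dot _ _ _ (And4 aS bS cS dS).
rewrite /nd /swap13_24 /= [b + a]addrC subKr.
by rewrite aS bS cS dS bd bc [dot b a]dotC ab ac ad.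
Qed.

(** * Weights on the three pairings of a quadruple *)

Section Weights.

Variables (A B k : R).

(* Weights given to the pairings (12)(34) and (13)(24) of a quadruple; the
   pairing (14)(23) gets [w13] after exchanging the last two entries. *)
Definition w12 p : R := let: (a, b, c) := p in
  A + k * (2 * chi (- (2 * dot a b)) - chi (2 * dot a c)
           - chi (2 * dot a (a + b - c))).
Definition w13 p : R := let: (a, b, c) := p in
  B + k * (2 * chi (2 * dot a c) - chi (- (2 * dot a b))
           - chi (2 * dot a (a + b - c))).

Lemma w12_swap p : nd p -> w12 (swap12_34 p) = w12 p.
Proof.
case: p => [[a b] c] /and5P[aS bS cS dS _].
have [cd bd bc _] := cone_quad_dot _ _ _ (And4 aS bS cS dS).
have dE : c + (a + b - c) - a = b by rewrite [c + _]addrC subrK addrAC subrr add0r.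
by rewrite /w12 /swap12_34 /= dE cd [dot c b]dotC bc [dot c a]dotC.
Qed.

Lemma w13_swap p : nd p -> w13 (swap13_24 p) = w13 p.
Proof.
case: p => [[a b] c] /and5P[aS bS cS dS _].
have [cd bd bc _] := cone_quad_dot _ _ _ (And4 aS bS cS dS).
by rewrite /w13 /swap13_24 /= [b + a]addrC subKr bd bc [dot b a]dotC.
Qed.

(** The three characters enter the three weights with coefficients 2, -1, -1 in rotation, so they
    cancel. *)
Lemma w_sum p : A + 2 * B = 1 -> w12 p + w13 p + w13 (swap34 p) = 1.
Proof.
case: p => [[a b] c] AB.
by rewrite /w12 /w13 /swap34 /= subKr -[RHS]AB; ring.
Qed.

(** The worst case has characters -1, 1, 1, which leaves [A - 4 k]. *)
Lemma w12_ge0 p : 0 <= k -> 4 * k <= A -> 0 <= w12 p.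
Proof.
case: p => [[a b] c] k0 kA; rewrite /w12.
have h1 := qchar_ge (R := R) (- (2 * dot a b)).
have h2 := qchar_le1 (R := R) odd_char (2 * dot a c).
have h3 := qchar_le1 (R := R) odd_char (2 * dot a (a + b - c)).
move: h1 h2 h3; set x := chi _; set y := chi _; set z := chi _ => h1 h2 h3.
by nra.
Qed.

Lemma w13_ge0 p : 0 <= k -> 4 * k <= B -> 0 <= w13 p.
Proof.
case: p => [[a b] c] k0 kA; rewrite /w13.
have h1 := qchar_ge (R := R) (2 * dot a c).
have h2 := qchar_le1 (R := R) odd_char (- (2 * dot a b)).
have h3 := qchar_le1 (R := R) odd_char (2 * dot a (a + b - c)).
move: h1 h2 h3; set x := chi _; set y := chi _; set z := chi _ => h1 h2 h3.
by nra.
Qed.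

Lemma sum_w12 a b : a \in cone F -> b \in cone F -> dot a b != 0 ->
  let s := chi (- (2 * dot a b)) in
  \sum_(c | nd (a, b, c)) w12 (a, b, c) =
  (A + 2 * k * s) * (q - 2 - s) + 2 * k * (1 + chi (2 * dot a b)).
Proof.
move=> aS bS ab s.
have := sum_nd_c (A + 2 * k * s) (- k) a b aS bS ab.
rewrite mulrN mulNr opprK => <-; apply: eq_bigr => c _.
by rewrite /w12 -/s; ring.
Qed.

Lemma sum_w13 a c : a \in cone F -> c \in cone F -> dot a c != 0 ->
  let s := chi (2 * dot a c) in
  \sum_(b | nd (a, b, c)) w13 (a, b, c) =
  (B + 2 * k * s) * (q - 2 - s) + 2 * k * (1 + chi (- (2 * dot a c))).
Proof.
move=> aS cS ac s.
have := sum_nd_b (B + 2 * k * s) (- k) a c aS cS ac.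
rewrite mulrN mulNr opprK => <-; apply: eq_bigr => b _.
by rewrite /w13 -/s; ring.
Qed.

End Weights.

Lemma card_odd_ge3 : 3 <= q.
Proof.
have u : uniq [:: 0; 1; -1 : F].
  rewrite /= !inE negb_or [0 == 1]eq_sym oner_eq0 [0 == -1]eq_sym oppr_eq0.
  by rewrite oner_eq0 /= andbT -subr_eq0 opprK.
by have := max_card (mem [:: 0; 1; -1 : F]); rewrite (card_uniqP u) (ler_nat R 3).
Qed.

(* The left-hand side is the total weight that the quadruples put on a pair
   with dot product [t / 2]. With equal weights it still depends on [chi t] when
   [-1] is a square; the character terms in [w12] and [w13] remove that. *)
Lemma exists_weights : exists A B k : R,
  [/\ A + 2 * B = 1, 0 <= k, 4 * k <= A, 4 * k <= B
    & forall t : F, t != 0 ->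
        let s := chi (- t) in let s' := chi t in
        (A + 2 * k * s) * (q - 2 - s) + 2 * k * (1 + s')
        + 2 * ((B + 2 * k * s') * (q - 2 - s') + 2 * k * (1 + s)) = q - 2].
Proof.
have n1 : -1 != 0 :> F by rewrite oppr_eq0 oner_neq0.
have q3 := card_odd_ge3.
have chiN t : chi (- t) = chi (-1) * chi t by rewrite -qcharM ?mulN1r.
case: (qchar_pm1 (R := R) odd_char _ n1) => e.
  (* Here [s = s'], and the coefficient of [s] in the total is [6 k (q - 1) - 1]. The constraint
     [4 k <= 1/3] amounts to [q >= 3]. *)
  exists 3^-1, 3^-1, (6 * (q - 1))^-1.
  have k4 : 4 * (6 * (q - 1))^-1 <= 3^-1.
    rewrite ler_pdivrMr; last by lra.
    by lra.
  have q1 : q - 1 != 0 by rewrite gt_eqF //; lra.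
  split=> //; first by field.
    by rewrite invr_ge0; lra.
  move=> t t0 /=; rewrite chiN e mul1r.
  by case: (qchar_pm1 (R := R) odd_char _ t0) => ->; field.
(* Here [s' = - s], so the characters cancel without correction once [A = 2 B]. *)
exists 2^-1, 4^-1, 0; split; rewrite ?mulr0 ?invr_ge0 //; try lra.
move=> t t0 /=; rewrite chiN e.
by case: (qchar_pm1 (R := R) odd_char _ t0) => ->; field.
Qed.

End Energy.

(** * Evaluation of the additive energy, case by case *)

Section EnergyBound.

Context {R : realFieldType} {F : finFieldType}.
Hypothesis odd_char : (2 : F) != 0.
Notation V := 'rV[F]_3.
Notation q := (#|F|%:R : R).
Implicit Types (a b c d : V) (p : V * V * V).

Variable g : V -> R.
Hypothesis g_supp : forall a, a \notin cone F -> g a = 0.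

Definition const_on_cone := forall a b, a \in cone F -> b \in cone F -> g a = g b.

Definition quad p : R := g p.1.1 * g p.1.2 * (g p.2 * g (p.1.1 + p.1.2 - p.2)).

Lemma quad_swap13_24 p : quad p =
  (g p.1.1 * g p.2) * (g (swap13_24 p).1.1 * g (swap13_24 p).2).
Proof. by rewrite /quad /=; ring. Qed.

Lemma quad_swap34 p : quad (swap34 p) = quad p.
Proof. by rewrite /quad /= subKr [g (_ - _) * _]mulrC. Qed.

Lemma sum_nd_pair (K : V * V -> R) (w : V * V * V -> R) :
    (forall a b, a \in cone F -> b \in cone F -> dot a b != 0 ->
       \sum_(c | nd (a, b, c)) w (a, b, c) = K (a, b)) ->
  \sum_(p | nd p) w p * (g p.1.1 * g p.1.2) ^+ 2 =
  \sum_a \sum_(b | dot a b != 0) K (a, b) * (g a * g b) ^+ 2.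
Proof.
move=> HK; rewrite sum_tripleE; apply: eq_bigr => a _.
rewrite [RHS]big_mkcond /=; apply: eq_bigr => b _.
have [aS|aS] := boolP (a \in cone F); last first.
  by rewrite big_pred0 => [|c]; rewrite ?(negPf aS) // (g_supp _ aS) mul0r expr0n mulr0 if_same.
have [bS|bS] := boolP (b \in cone F); last first.
  by rewrite big_pred0 => [|c]; rewrite ?(negPf bS) ?andbF // (g_supp _ bS) mulr0 expr0n mulr0 if_same.
case: ifP => ab; last by rewrite big_pred0 => // c; rewrite !andbF.
rewrite -HK // mulr_suml; by apply: eq_bigl => c; rewrite /= aS bS ab.
Qed.

Lemma sum_nd_pair13 (K : V * V -> R) (w : V * V * V -> R) :
    (forall a c, a \in cone F -> c \in cone F -> dot a c != 0 ->
       \sum_(b | nd (a, b, c)) w (a, b, c) = K (a, c)) ->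
  \sum_(p | nd p) w p * (g p.1.1 * g p.2) ^+ 2 =
  \sum_a \sum_(c | dot a c != 0) K (a, c) * (g a * g c) ^+ 2.
Proof.
move=> HK; rewrite sum_tripleE; apply: eq_bigr => a _.
rewrite (exchange_big_dep xpredT) //= [RHS]big_mkcond /=; apply: eq_bigr => c _.
have [aS|aS] := boolP (a \in cone F); last first.
  by rewrite big_pred0 => [|b]; rewrite ?(negPf aS) // (g_supp _ aS) mul0r expr0n mulr0 if_same.
have [cS|cS] := boolP (c \in cone F); last first.
  by rewrite big_pred0 => [|b]; rewrite ?(negPf cS) ?andbF // (g_supp _ cS) mulr0 expr0n mulr0 if_same.
case: ifP => ac; last by rewrite big_pred0 => // b; rewrite !andbF.
by rewrite -HK // mulr_suml; apply: eq_bigl => b; rewrite /= aS cS ac.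
Qed.

(** [D] collects the weighted squares lost in AM-GM. Later only its sign and its vanishing for
    constant [g] matter. *)
Lemma nd_energy : exists D : R, [/\ 0 <= D, const_on_cone -> D = 0
  & \sum_(p | nd p) quad p =
    (q - 2) * (\sum_a \sum_(b | dot a b != 0) (g a * g b) ^+ 2) - D].
Proof.
have [A [B [k [AB k0 kA kB HK]]]] := exists_weights (R := R) odd_char.
have nd12 := nd_swap12_34 odd_char; have nd13 := nd_swap13_24 odd_char.
have nd34 := @nd_swap34 F.
pose x p := g p.1.1 * g p.1.2; pose y p := g p.1.1 * g p.2.
pose D12 := \sum_(p | nd p) w12 A k p * (x p - x (swap12_34 p)) ^+ 2 / 2.
pose D13 := \sum_(p | nd p) w13 B k p * (y p - y (swap13_24 p)) ^+ 2 / 2.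
exists (D12 + 2 * D13); split.
- have w0 p : 0 <= w12 A k p by apply: w12_ge0.
  have w0' p : 0 <= w13 B k p by apply: w13_ge0.
  apply: addr_ge0; [|apply: mulr_ge0; first exact: ler0n];
    apply: sumr_ge0 => p _; apply: divr_ge0; rewrite ?ler0n //;
    apply: mulr_ge0; rewrite ?w0 ?w0' ?sqr_ge0 //.
- move=> cst.
  have E p : nd p -> x p - x (swap12_34 p) = 0 /\ y p - y (swap13_24 p) = 0.
    case: p => [[a b] c] /and5P[aS bS cS dS _]; rewrite /x /y /=.
    by rewrite (cst _ _ dS aS) (cst _ _ cS aS) (cst _ _ bS aS) subrr.
  rewrite /D12 /D13 !big1 ?mulr0 ?addr0 // => p /E[e12 e13].
    by rewrite e13 expr0n mulr0 mul0r.
  by rewrite e12 expr0n mulr0 mul0r.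
(* The weights sum to 1, and the third pairing becomes the second under [swap34], whence the factor
   2. *)
have E : \sum_(p | nd p) quad p = \sum_(p | nd p) w12 A k p * quad p
    + 2 * \sum_(p | nd p) w13 B k p * quad p.
  have e : \sum_(p | nd p) w13 B k p * quad p =
            \sum_(p | nd p) w13 B k (swap34 p) * quad p.
    rewrite (reindex_inj (inv_inj swap34K)) /=.
    by apply: eq_big => [p|p _]; [exact: nd34|rewrite quad_swap34].
  rewrite mulr2n mulrDl mul1r [X in _ + (_ + X)]e -!big_split /=.
  apply: eq_bigr => p _; have /(congr1 ( *%R^~ (quad p))) := w_sum A B k p AB.
  by rewrite mul1r => e1; rewrite -[LHS]e1 !mulrDl addrA.
rewrite E.
have -> : \sum_(p | nd p) w12 A k p * quad p =
    \sum_(p | nd p) w12 A k p * (x p * x (swap12_34 p)) by [].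
have -> : \sum_(p | nd p) w13 B k p * quad p =
    \sum_(p | nd p) w13 B k p * (y p * y (swap13_24 p)).
  by apply: eq_bigr => p _; rewrite quad_swap13_24.
rewrite (sum_involution_amgm _ _ _ _ swap12_34K nd12); last exact: w12_swap.
rewrite (sum_involution_amgm _ _ _ _ swap13_24K nd13); last exact: w13_swap.
rewrite -/D12 -/D13.
pose s (t : F) := qchar t : R.
pose K12 (r : V * V) := let t := 2 * dot r.1 r.2 in
  (A + 2 * k * s (- t)) * (q - 2 - s (- t)) + 2 * k * (1 + s t).
pose K13 (r : V * V) := let t := 2 * dot r.1 r.2 in
  (B + 2 * k * s t) * (q - 2 - s t) + 2 * k * (1 + s (- t)).
rewrite (sum_nd_pair K12); last by move=> a b aS bS ab; rewrite sum_w12.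
rewrite (sum_nd_pair13 K13); last by move=> a b aS bS ab; rewrite sum_w13.
have -> X Y : X - D12 + 2 * (Y - D13) = (X + 2 * Y) - (D12 + 2 * D13) by ring.
congr (_ - _); rewrite mulr_sumr mulr_sumr -big_split; apply: eq_bigr => a _.
rewrite mulr_sumr mulr_sumr -big_split; apply: eq_bigr => b ab /=.
by rewrite [2 * _]mulrA -mulrDl HK ?mulf_neq0.
Qed.

(** Orthogonal isotropic vectors are proportional, so these quadruples lie on one line. The case
    [b = - a] is left out because there [c] ranges over the whole cone. *)
Definition coll p := let: (a, b, c) := p in
  [&& a \in cone F, b \in cone F, c \in cone F, a + b - c \in cone F,
      dot a b == 0 & b != - a].

Lemma coll_swap12_34 p : coll (swap12_34 p) = coll p.
Proof.
apply: (involution_pred coll _ swap12_34K) => -[[a b] c] /and5P[aS bS cS dS /andP[ab ba]].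
have [cd bd bc _] := cone_quad_dot odd_char _ _ _ (And4 aS bS cS dS).
have dE : c + (a + b - c) - a = b by rewrite [c + _]addrC subrK addrAC subrr add0r.
rewrite /coll /swap12_34 /= dE aS bS cS dS cd ab /=.
by rewrite -addr_eq0 subrK addrC addr_eq0.
Qed.

(** Isotropy of [c] and [a - c] forces [a.c = 0], so [c = t a], with [t] different from 0 and 1. *)
Lemma card_cone_line a : a \in cone F ->
  \sum_(c | (c \in cone F) && (a - c \in cone F)) 1 = q - 2 :> R.
Proof.
move=> aS; have a0 := cone_neq0 _ aS; have aa := cone_dot _ aS.
have inj := scalel_inj a a0.
rewrite sumr_const -[#|_|](_ : #|[set t *: a | t in ~: [set 0; 1 : F]]| = _).
  rewrite card_imset // cardsCs setCK cards2 eq_sym oner_eq0 /=.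
  by rewrite natrB // -(ler_nat R); have := card_odd_ge3 (R := R) odd_char; lra.
apply: eq_card => c; apply/imsetP/andP => [[t]|[cS acS]].
  rewrite in_setC in_set2 negb_or => /andP[t0 t1] ->.
    rewrite -[X in X - _]scale1r -scalerBl !coneZ ?subr_eq0 //.
  by rewrite eq_sym.
have ac : dot a c = 0.
  have := cone_dot _ acS; rewrite !(dotDl, dotDr, dotNl, dotNr) aa (cone_dot _ cS).
  rewrite [dot c a]dotC => E; apply: (mulfI odd_char).
  by rewrite mulr0 -oppr0 -E; ring.
have [t ct] := isotropic_orth _ _ (cone_dot _ cS) aa (etrans (dotC c a) ac) a0.
exists t => //; rewrite !inE negb_or; apply/andP; split.
  by apply: contraNneq (cone_neq0 _ cS) => t0; rewrite ct t0 scale0r.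
by apply: contraNneq (cone_neq0 _ acS) => t1; rewrite ct t1 scale1r subrr.
Qed.

Lemma coll_energy : exists D : R, [/\ 0 <= D, const_on_cone -> D = 0
  & \sum_(p | coll p) quad p =
    (q - 2) * (\sum_a \sum_(b | (dot a b == 0) && (b != - a)) (g a * g b) ^+ 2) - D].
Proof.
pose x p := g p.1.1 * g p.1.2.
pose D := \sum_(p | coll p) 1 * (x p - x (swap12_34 p)) ^+ 2 / 2.
exists D; split.
- by apply: sumr_ge0 => p _; rewrite mul1r divr_ge0 ?sqr_ge0 ?ler0n.
- move=> cst; rewrite /D big1 // => -[[a b] c] /and5P[aS bS cS dS _].
  by rewrite /x /= (cst _ _ dS aS) (cst _ _ cS aS) (cst _ _ bS aS) subrr expr0n mulr0 mul0r.
have -> : \sum_(p | coll p) quad p =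
    \sum_(p | coll p) 1 * (x p * x (swap12_34 p)).
  by apply: eq_bigr => p _; rewrite mul1r.
rewrite (sum_involution_amgm _ _ (fun=> 1) _ swap12_34K coll_swap12_34) // -/D.
congr (_ - _); rewrite sum_tripleE mulr_sumr; apply: eq_bigr => a _.
rewrite mulr_sumr [RHS]big_mkcond; apply: eq_bigr => b _ /=.
have [aS|aS] := boolP (a \in cone F); last first.
  by rewrite big_pred0 // (g_supp _ aS) mul0r expr0n mulr0 if_same.
have [bS|bS] := boolP (b \in cone F); last first.
  by rewrite big_pred0 // (g_supp _ bS) mulr0 expr0n mulr0 if_same.
case: ifP => /= [/andP[/eqP ab ba]|ab]; last first.
  by rewrite big_pred0 // => c; rewrite ?ab !andbF.
have abS : a + b \in cone F.
  rewrite coneE addrC addr_eq0 ba !(dotDl, dotDr) !cone_dot // [dot b a]dotC ab.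
  by rewrite !addr0 eqxx.
rewrite -(card_cone_line _ abS) mulr_suml; apply: eq_bigl => c.
by rewrite andbT.
Qed.

(** The only partners outside [nd] are [c = a] and [c = b]. If [a.c = 0], then [c = t a], and
    [b.c = a.b] gives [t = 1]; the case [a.d = 0] is the same for [d]. *)
Lemma sum_dot_neq0 a b : a \in cone F -> b \in cone F -> dot a b != 0 ->
  \sum_c g c * g (a + b - c) =
  \sum_(c | nd (a, b, c)) g c * g (a + b - c) + 2 * (g a * g b).
Proof.
move=> aS bS ab; have [aa bb] := (cone_dot _ aS, cone_dot _ bS).
have ba : b != a by apply: contraNneq ab => ->; rewrite aa.
rewrite (bigD1 a) //= (bigD1 b) //= addrK [a + b - a]addrAC subrr add0r.
rewrite addrA [RHS]addrC; congr (_ + _); first by ring.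
rewrite big_mkcond [RHS]big_mkcond; apply: eq_bigr => c _ /=.
rewrite aS bS ab /=.
have [cS|cS] := boolP (c \in cone F); last by rewrite (g_supp _ cS) mul0r if_same.
have [dS|dS] := boolP (a + b - c \in cone F); last first.
  by rewrite (g_supp _ dS) mulr0 if_same.
have [cd bd bc ad] := cone_quad_dot odd_char _ _ _ (And4 aS bS cS dS).
have E (d : V) : dot d d = 0 -> dot a d = 0 -> dot b d = dot a b -> d = a.
  move=> dd ad0 bdE.
  have [t dt] := isotropic_orth _ _ dd aa (etrans (dotC d a) ad0) (cone_neq0 _ aS).
  move: bdE; rewrite dt dotZr [dot b a]dotC -[RHS]mul1r => /(mulIf ab) ->.
  by rewrite scale1r.
rewrite /=; congr (if _ then _ else _); apply/idP/idP => /andP[h1 h2]; apply/andP; split.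
- apply: contraNneq h1 => ac0; rewrite (E c) ?cone_dot // bc ad ac0.
  by rewrite subr0.
- apply: contraNneq h2 => ad0; have := E (a + b - c) (cone_dot _ dS) ad0.
  rewrite bd; have -> : dot a c = dot a b by apply/esym/eqP; rewrite -subr_eq0 -ad ad0.
  by move=> /(_ erefl) e; rewrite -(subKr (a + b) c) e addrAC subrr add0r.
- by apply: contraNneq h1 => ->; rewrite aa.
by apply: contraNneq h2 => ->; rewrite addrK aa.
Qed.

(** In the notation of the overview, [total], [antipodal], [antipodal2] and [collinear] are U, Y, Z
    and T. *)
Definition total := \sum_a g a ^+ 2.
Definition antipodal := \sum_a g a * g (- a).
Definition antipodal2 := \sum_a (g a * g (- a)) ^+ 2.
Definition collinear := \sum_a \sum_(b | dot a b == 0) (g a * g b) ^+ 2.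
Definition energy := \sum_p quad p.

Lemma sum_antipodal_coll :
  \sum_a \sum_(b | (dot a b == 0) && (b != - a)) (g a * g b) ^+ 2 =
  collinear - antipodal2.
Proof.
rewrite -sumrB; apply: eq_bigr => a _.
have [aS|aS] := boolP (a \in cone F); last first.
  rewrite (g_supp _ aS) mul0r expr0n subr0 !big1 // => b _; by rewrite mul0r expr0n.
by rewrite [in RHS](bigD1 (- a)) /= ?dotNr ?cone_dot ?oppr0 //; ring.
Qed.

Lemma sum_dot_neq0_total :
  \sum_a \sum_(b | dot a b != 0) (g a * g b) ^+ 2 = total ^+ 2 - collinear.
Proof.
have -> : total ^+ 2 = \sum_a \sum_b (g a * g b) ^+ 2.
  rewrite expr2 mulr_suml; apply: eq_bigr => a _; rewrite mulr_sumr.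
  by apply: eq_bigr => b _; rewrite exprMn.
rewrite -sumrB; apply: eq_bigr => a _.
by rewrite [in RHS](bigID (fun b => dot a b == 0)) /=; ring.
Qed.

Lemma energy_split : energy = antipodal ^+ 2 + \sum_(p | coll p) quad p
  + (\sum_(p | nd p) quad p + 2 * (total ^+ 2 - collinear)).
Proof.
rewrite -sum_dot_neq0_total /energy !sum_tripleE mulr_sumr expr2 mulr_suml -!big_split /=.
apply: eq_bigr => a _.
(* The square of Y is spread over [b] as an indicator of [b = - a], so that both sides can be
   compared for each pair [(a, b)]. *)
have -> : g a * g (- a) * antipodal =
   \sum_b if b == - a then g a * g b * antipodal else 0.
  by rewrite -big_mkcond big_pred1_eq.
rewrite [X in 2 * X]big_mkcond mulr_sumr -!big_split; apply: eq_bigr => b _ /=.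
rewrite /quad /= -mulr_sumr.
have [aS|aS] := boolP (a \in cone F); last first.
  rewrite (g_supp _ aS) !mul0r expr0n !if_same mulr0 add0r addr0.
  by rewrite !big1 ?addr0 // => c _; rewrite mul0r.
have [bS|bS] := boolP (b \in cone F); last first.
  rewrite (g_supp _ bS) !mulr0 !mul0r expr0n !if_same mulr0 add0r addr0.
  by rewrite !big1 ?addr0 // => c _; rewrite mul0r.
have [->|ba] := eqVneq b (- a).
  rewrite dotNr cone_dot // oppr0 eqxx /=.
  have F1 c : [&& c \in cone F, a - a - c \in cone F & false] = false.
    by rewrite !andbF.
  rewrite mulr0 !(big_pred0 _ _ _ _ F1) !addr0; congr (_ * _).
  by apply: eq_bigr => c _; rewrite subrr sub0r.
have F0 c : [&& c \in cone F, a + b - c \in cone F & false] = false.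
  by rewrite !andbF.
have [ab|ab] := eqVneq (dot a b) 0.
  rewrite /= add0r mulr0 addr0 (big_pred0 _ _ _ _ F0).
  rewrite addr0 mulr_sumr [RHS]big_mkcond; apply: eq_bigr => c _ /=.
  have [cS|cS] := boolP (c \in cone F); last by rewrite (g_supp _ cS) mul0r mulr0.
  have [dS|dS] := boolP (a + b - c \in cone F); last by rewrite (g_supp _ dS) !mulr0.
  by rewrite /=.
rewrite /= (big_pred0 _ _ _ _ F0).
rewrite !add0r sum_dot_neq0 // mulrDr mulr_sumr.
congr (_ + _); last by ring.
by apply: eq_bigl => c; rewrite /= aS bS ab.
Qed.

Lemma energy_eq : exists D : R, [/\ 0 <= D, const_on_cone -> D = 0
  & energy = antipodal ^+ 2 + (q - 2) * (collinear - antipodal2)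
             + q * (total ^+ 2 - collinear) - D].
Proof.
have [D1 [D1_ge0 D1_0 E1]] := nd_energy.
have [D2 [D2_ge0 D2_0 E2]] := coll_energy.
exists (D1 + D2); split; first exact: addr_ge0.
  by move=> cst; rewrite D1_0 // D2_0 // addr0.
rewrite energy_split E1 E2 sum_antipodal_coll sum_dot_neq0_total; ring.
Qed.

End EnergyBound.

(** The variance identity: Cauchy-Schwarz against a constant, with the defect that governs
    equality. *)
Lemma sum_sqr_dev {R : realFieldType} {I : finType} (A : {set I}) (x : I -> R) :
    A != set0 -> let n : R := #|A|%:R in let X := \sum_(i in A) x i in
  n * \sum_(i in A) (x i - X / n) ^+ 2 = n * \sum_(i in A) x i ^+ 2 - X ^+ 2.
Proof.
move=> A0 n X; have n0 : n != 0 by rewrite pnatr_eq0 cards_eq0.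
have -> : \sum_(i in A) (x i - X / n) ^+ 2 =
    \sum_(i in A) (x i ^+ 2 - 2 * (X / n) * x i + (X / n) ^+ 2).
  by apply: eq_bigr => i _; ring.
rewrite big_split sumrB /= -mulr_sumr sumr_const -mulr_natr -/X -/n.
by field.
Qed.

(** * Existence of isotropic points and the size of the cone *)

Section ConeSize.

Context {R : realFieldType} {F : finFieldType}.
Hypothesis odd_char : (2 : F) != 0.

Lemma cone_nonempty : exists a, a \in cone F.
Proof.
(* If [-1] is not a sum of two squares, [c |-> 1 + c] maps the squares
   injectively into the nonzero squares. *)
suff [x [y xy]] : exists x y : F, 1 + x ^+ 2 + y ^+ 2 = 0.
  exists (\row_i [:: 1; x; y]`_i); rewrite coneE dot3E !mxE /= -!expr2 expr1n xy eqxx.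
  rewrite andbT; apply/eqP => /(congr1 (fun v : 'rV[F]_3 => v 0 0)).
  by rewrite !mxE /= => /eqP; rewrite oner_eq0.
have [/existsP[x /existsP[y /eqP E]]|] :=
  boolP [exists x : F, exists y : F, 1 + x ^+ 2 + y ^+ 2 == 0].
  by exists x, y.
rewrite negb_exists => /forallP H.
have {}H (x y : F) : 1 + x ^+ 2 + y ^+ 2 != 0.
  by have := H x; rewrite negb_exists => /forallP.
have n1 : -1 != 0 :> F by rewrite oppr_eq0 oner_neq0.
pose A := [set y ^+ 2 | y in F].
have sub : [set 1 + c | c in A] \subset A :\ 0.
  apply/subsetP => _ /imsetP[_ /imsetP[y _ ->] ->].
  have y0 : 1 + y ^+ 2 != 0 by have := H y 0; rewrite expr0n addr0.
  rewrite !inE y0 /=.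
  (* By [H], both -1 and [- (1 + y^2)] are nonsquares, so multiplicativity makes [1 + y^2] a
     square. *)
  case: (qcharP (R := rat) _ n1) => [m1|[k _ k2]]; last first.
    by have := H 0 k; rewrite expr0n addr0 -k2 subrr eqxx.
  have ny0 : - (1 + y ^+ 2) != 0 by rewrite oppr_eq0.
  case: (qcharP (R := rat) _ ny0) => [e|[k _ k2]]; last first.
    by have := H y k; rewrite -k2 subrr eqxx.
  case: (qcharP (R := rat) _ y0) => [e'|[k _ ->]]; last exact: imset_f.
  have := qcharM (R := rat) odd_char (-1) (1 + y ^+ 2).
  by rewrite mulN1r e m1 e' => /eqP.
have := subset_leq_card sub; rewrite card_imset; last exact: addrI.
have A0 : 0 \in A by apply/imsetP; exists 0; rewrite ?expr0n.
by rewrite [X in (X <= _)%N](cardsD1 0) A0 ltnn.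
Qed.

Lemma cone_neq_set0 : cone F != set0.
Proof. by have [a aS] := cone_nonempty; apply/set0Pn; exists a. Qed.

(** One punctured line in the cone suffices; the bound keeps the coefficient [s - q + 2] of [slackE]
    positive. *)
Lemma card_cone_ge : #|F|%:R - 1 <= #|cone F|%:R :> R.
Proof.
have [a aS] := cone_nonempty; have a0 := cone_neq0 _ aS.
have inj := scalel_inj a a0.
have : [set t *: a | t in ~: [set 0 : F]] \subset cone F.
  apply/subsetP => _ /imsetP[t t0 ->].
  by move: t0; rewrite in_setC in_set1 => t0; rewrite coneZ.
move/subset_leq_card; rewrite card_imset // cardsC1 -(ler_nat R).
by rewrite -subn1 natrB // (cardD1 0).
Qed.

End ConeSize.

(** * The sharp energy inequality *)

Section EnergyInequality.

Context {R : realFieldType} {F : finFieldType}.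
Hypothesis odd_char : (2 : F) != 0.
Notation V := 'rV[F]_3.
Notation q := (#|F|%:R : R).
Notation s := (#|cone F|%:R : R).
Implicit Types (a b c d : V) (t : F).

Variable g : V -> R.
Hypothesis g_supp : forall a, a \notin cone F -> g a = 0.
Hypothesis g_ge0 : forall a, 0 <= g a.

Let line_mass a := \sum_(t | t != 0) g (t *: a) ^+ 2.

Lemma sum_orth_cone a : a \in cone F ->
  \sum_(b | dot a b == 0) g b ^+ 2 = line_mass a.
Proof.
move=> aS; have a0 := cone_neq0 _ aS; have aa := cone_dot _ aS.
have inj := scalel_inj a a0.
rewrite /line_mass -(big_imset (fun b => g b ^+ 2) (h := fun t => t *: a) (A := fun t => t != 0)) /=; last first.
  by move=> x y _ _; apply: inj.
rewrite big_mkcond [RHS]big_mkcond; apply: eq_bigr => b _.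
have [bS|bS] := boolP (b \in cone F); last by rewrite g_supp // expr0n !if_same.
congr (if _ then _ else _); apply/idP/imsetP => [/eqP ab|[t t0 ->]].
  have [t bt] := isotropic_orth _ _ (cone_dot _ bS) aa (etrans (dotC b a) ab) a0.
  exists t => //; rewrite unfold_in.
  by apply: contraNneq (cone_neq0 _ bS) => t0; rewrite bt t0 scale0r.
by rewrite dotZr aa mulr0.
Qed.

Lemma collinearE : collinear g = \sum_a g a ^+ 2 * line_mass a.
Proof.
apply: eq_bigr => a _; have [aS|aS] := boolP (a \in cone F); last first.
  by rewrite g_supp // expr0n mul0r big1 // => b _; rewrite mul0r expr0n.
by rewrite -sum_orth_cone // mulr_sumr; apply: eq_bigr => b _; rewrite exprMn.
Qed.

Lemma sum_nonzero : \sum_(t : F | t != 0) 1 = q - 1 :> R.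
Proof.
by rewrite sumr_const cardC1 -subn1 natrB // (cardD1 0).
Qed.

Lemma sum_line_mass : \sum_a line_mass a = (q - 1) * total g.
Proof.
rewrite exchange_big /= -sum_nonzero mulr_suml; apply: eq_bigr => t t0.
by rewrite mul1r [RHS](reindex_inj (scalerI t0)).
Qed.

(** Since [line_mass] is constant along punctured lines, one factor can be opened over the line and
    the scalar absorbed by reindexing. *)
Lemma sum_line_mass_sqr : \sum_a line_mass a ^+ 2 = (q - 1) * collinear g.
Proof.
have lineZ t a : t != 0 -> line_mass (t *: a) = line_mass a.
  move=> t0; rewrite /line_mass [RHS](reindex_inj (mulIf t0)) /=.
  apply: eq_big => [r|r _]; first by rewrite mulf_eq0 negb_or t0 andbT.
  by rewrite scalerA.
have -> : \sum_a line_mass a ^+ 2 =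
    \sum_a \sum_(t | t != 0) g (t *: a) ^+ 2 * line_mass (t *: a).
  apply: eq_bigr => a _; rewrite expr2 {1}/line_mass mulr_suml.
  by apply: eq_bigr => t t0; rewrite lineZ.
rewrite exchange_big /= collinearE -sum_nonzero mulr_suml.
by apply: eq_bigr => t t0; rewrite mul1r [RHS](reindex_inj (scalerI t0)).
Qed.

(** Cauchy-Schwarz for [line_mass] over the cone, divided by [q - 1]. *)
Lemma collinear_ge : (q - 1) * total g ^+ 2 <= s * collinear g.
Proof.
have q3 := card_odd_ge3 (R := R) odd_char.
have supp (k : R -> R) : k 0 = 0 ->
    \sum_(a in cone F) k (line_mass a) = \sum_a k (line_mass a).
  move=> k0; rewrite big_mkcond; apply: eq_bigr => a _; case: ifP => // /negbT aS.
  rewrite /line_mass big1 // => t t0.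
  by rewrite g_supp ?expr0n // coneZ.
have := sum_sqr_dev (cone F) line_mass (cone_neq_set0 odd_char).
rewrite /= (supp id) // (supp (fun x => x ^+ 2)) ?expr0n //.
rewrite sum_line_mass_sqr sum_line_mass => E.
have : 0 <= s * \sum_(a in cone F) (line_mass a - (q - 1) * total g / s) ^+ 2.
  by rewrite mulr_ge0 ?ler0n ?sumr_ge0 // => a _; rewrite sqr_ge0.
rewrite E => ge0.
rewrite -(ler_pM2l (_ : 0 < q - 1)); last by lra.
by nra.
Qed.

(** The gap is kept as a sum of squares so that equality forces [g] to be even. *)
Lemma total_antipodal :
  total g - antipodal g = \sum_a (g a - g (- a)) ^+ 2 / 2.
Proof.
have E : total g = \sum_a g (- a) ^+ 2 by rewrite /total (reindex_inj oppr_inj).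
have -> : total g = \sum_a (g a ^+ 2 + g (- a) ^+ 2) / 2.
  by rewrite -mulr_suml big_split /= -E -/(total g); field.
by rewrite -sumrB; apply: eq_bigr => a _; field.
Qed.

Lemma antipodal_le : antipodal g <= total g.
Proof.
rewrite -subr_ge0 total_antipodal; apply: sumr_ge0 => a _.
by rewrite divr_ge0 ?sqr_ge0 ?ler0n.
Qed.

Lemma antipodal_ge0 : 0 <= antipodal g.
Proof. by apply: sumr_ge0 => a _; rewrite mulr_ge0. Qed.

Lemma antipodal2E : s * antipodal2 g - antipodal g ^+ 2 =
  s * \sum_(a in cone F) (g a * g (- a) - antipodal g / s) ^+ 2.
Proof.
have supp (k : R -> R) : k 0 = 0 ->
    \sum_(a in cone F) k (g a * g (- a)) = \sum_a k (g a * g (- a)).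
  move=> k0; rewrite big_mkcond; apply: eq_bigr => a _; case: ifP => // /negbT aS.
  by rewrite g_supp // mul0r.
have := sum_sqr_dev (cone F) (fun a => g a * g (- a)) (cone_neq_set0 odd_char).
by rewrite /= (supp id) // (supp (fun x => x ^+ 2)) ?expr0n.
Qed.

Lemma antipodal2_ge : antipodal g ^+ 2 <= s * antipodal2 g.
Proof.
rewrite -subr_ge0 antipodal2E mulr_ge0 ?ler0n ?sumr_ge0 // => a _.
exact: sqr_ge0.
Qed.

Let slack : R := (q + 1 - (3 * q - 4) / s) * total g ^+ 2 - energy g.

(** The gap in the energy bound, cleared of its denominator, is a combination of the three
    elementary gaps and the AM-GM loss. The constant arises as [3 q - 4 = 2 (q - 1) + (q - 2)]. *)
Lemma slackE : exists D : R, [/\ 0 <= D, const_on_cone g -> D = 0 &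
  s * slack = 2 * (s * collinear g - (q - 1) * total g ^+ 2)
    + (q - 2) * (s * antipodal2 g - antipodal g ^+ 2)
    + (s - q + 2) * (total g ^+ 2 - antipodal g ^+ 2) + s * D].
Proof.
have [D [D0 Dc E]] := energy_eq odd_char _ g_supp.
exists D; split => //; rewrite /slack E.
have s0 : s != 0 by rewrite pnatr_eq0 cards_eq0 cone_neq_set0.
by field.
Qed.

Lemma energy_le : energy g <= (q + 1 - (3 * q - 4) / s) * total g ^+ 2.
Proof.
have q3 := card_odd_ge3 (R := R) odd_char.
have sq := card_cone_ge (R := R) odd_char.
have s0 : 0 < s by lra.
rewrite -subr_ge0 -/slack -(pmulr_rge0 _ s0); have [D [D0 _ ->]] := slackE.
have h1 := collinear_ge; have h2 := antipodal2_ge.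
have h3 : antipodal g ^+ 2 <= total g ^+ 2.
  by rewrite ler_sqr ?nnegrE ?antipodal_le ?antipodal_ge0 ?(le_trans antipodal_ge0) ?antipodal_le.
have h4 : 0 <= s * D by rewrite mulr_ge0 ?ler0n.
have h5 : 0 <= (q - 2) * (s * antipodal2 g - antipodal g ^+ 2).
  by apply: mulr_ge0; [lra|rewrite subr_ge0].
have h6 : 0 <= (s - q + 2) * (total g ^+ 2 - antipodal g ^+ 2).
  by apply: mulr_ge0; [lra|rewrite subr_ge0].
lra.
Qed.

Lemma energy_const : const_on_cone g ->
  energy g = (q + 1 - (3 * q - 4) / s) * total g ^+ 2.
Proof.
move=> cst; have [a0 a0S] := cone_nonempty odd_char; pose k := g a0.
have gE a : a \in cone F -> g a = k by move=> aS; apply: cst.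
have sumE (f : R -> R) (h : V -> R) : (forall a, a \in cone F -> h a = f k) ->
    (forall a, a \notin cone F -> h a = 0) -> \sum_a h a = s * f k.
  move=> hS h0; rewrite (bigID (mem (cone F))) /= [X in _ + X]big1 // addr0.
  by rewrite (eq_bigr (fun=> f k) hS) sumr_const mulr_natl.
have U : total g = s * k ^+ 2.
  rewrite [LHS](sumE (fun x => x ^+ 2)) // => a aS; first by rewrite gE.
  by rewrite g_supp // expr0n.
have Y : antipodal g = s * k ^+ 2.
  rewrite [LHS](sumE (fun x => x ^+ 2)) // => a aS; first by rewrite !gE ?coneN // expr2.
  by rewrite g_supp // mul0r.
have Z : antipodal2 g = s * k ^+ 4.
  rewrite [LHS](sumE (fun x => x ^+ 4)) // => a aS; first by rewrite !gE ?coneN //; ring.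
  by rewrite g_supp // mul0r expr0n.
have T : collinear g = s * ((q - 1) * k ^+ 4).
  rewrite collinearE (sumE (fun x => (q - 1) * x ^+ 4)) // => a aS; last first.
    by rewrite g_supp // expr0n mul0r.
  rewrite /line_mass (eq_bigr (fun=> k ^+ 2 * 1)) => [|t t0]; last first.
    by rewrite mulr1 gE ?coneZ.
  by rewrite -mulr_sumr sum_nonzero gE //; ring.
have s0 : s != 0 by rewrite pnatr_eq0 cards_eq0 cone_neq_set0.
apply/eqP; rewrite eq_sym -subr_eq0 -/slack -(mulrI_eq0 _ (mulfI s0)).
have [D [_ Dc ->]] := slackE; rewrite Dc // U Y Z T; apply/eqP; ring.
Qed.

(** The coefficients [q - 2] and [s - q + 2] are positive, so the gaps for Z and Y vanish. Then [g]
    is even and [g a * g (- a) = g a ^ 2] is constant on the cone. *)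
Lemma energy_max : energy g = (q + 1 - (3 * q - 4) / s) * total g ^+ 2 ->
  const_on_cone g.
Proof.
have q3 := card_odd_ge3 (R := R) odd_char.
have sq := card_cone_ge (R := R) odd_char.
have s0 : 0 < s by lra.
move=> E; have [D [D0 _]] := slackE; rewrite /slack -E subrr mulr0.
have h1 := collinear_ge; have h2 := antipodal2_ge.
have h3 : antipodal g ^+ 2 <= total g ^+ 2.
  by rewrite ler_sqr ?nnegrE ?antipodal_le ?antipodal_ge0 ?(le_trans antipodal_ge0) ?antipodal_le.
move=> sl.
have sD : 0 <= s * D by rewrite mulr_ge0 ?ler0n.
have Z0 : s * antipodal2 g - antipodal g ^+ 2 = 0 by nra.
have Y0 : total g ^+ 2 - antipodal g ^+ 2 = 0 by nra.
have UY : total g - antipodal g = 0.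
  have := antipodal_le; have := antipodal_ge0; move: Y0; rewrite subr_sqr => /eqP.
  by rewrite mulf_eq0 => /orP[/eqP//|/eqP]; lra.
have even a : g (- a) = g a.
  move: UY; rewrite total_antipodal => /eqP; rewrite psumr_eq0 => [/allP/(_ a)|b _].
    rewrite mem_index_enum => /(_ isT); rewrite mulf_eq0 invr_eq0 pnatr_eq0 orbF.
    by rewrite sqrf_eq0 subr_eq0 => /eqP.
  by rewrite divr_ge0 ?sqr_ge0 ?ler0n.
have val a : a \in cone F -> g a ^+ 2 = antipodal g / s.
  move=> aS; move: Z0; rewrite antipodal2E => /eqP.
  rewrite mulf_eq0 gt_eqF //= psumr_eq0 => [/allP/(_ a)|b _]; last exact: sqr_ge0.
  rewrite mem_index_enum aS => /(_ isT) /=.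
  by rewrite even -expr2 sqrf_eq0 subr_eq0 => /eqP.
move=> a b aS bS; apply/eqP; rewrite -(@eqrXn2 _ 2) //.
by rewrite !val.
Qed.

End EnergyInequality.

(** * Fourier analysis *)

Section Fourier.

Context {R : realType} {F : finFieldType} {chi : F -> R[i]}.
Hypothesis hchi : nontrivial_additive_character chi.

Lemma normcE (z : R[i]) : `|z| = (normc z)%:C.
Proof. by []. Qed.

Lemma character_norm a : `|chi a| = 1.
Proof. by case: hchi => n1 _ _; rewrite normcE n1. Qed.

Lemma character0 : chi 0 = 1.
Proof.
have [_ add _] := hchi.
have c0 : chi 0 != 0 by rewrite -normr_eq0 character_norm oner_neq0.
by apply: (mulfI c0); rewrite -add addr0 mulr1.
Qed.

Lemma character_conj a : ((chi a)^*)%R = chi (- a).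
Proof.
have [_ add _] := hchi.
have c0 : chi a != 0 by rewrite -normr_eq0 character_norm oner_neq0.
by apply: (mulfI c0); rewrite -normCK character_norm expr1n -add subrr character0.
Qed.

Lemma sum_character n (v : 'rV[F]_n) :
  \sum_(x : 'rV[F]_n) chi (dot v x) = if v == 0 then (#|F| ^ n)%:R else 0.
Proof.
have [_ add [a a1]] := hchi.
have [->|v0] := eqVneq.
  rewrite (eq_bigr (fun=> 1)) => [|x _]; last by rewrite dot0l character0.
  by rewrite sumr_const card_mx mul1n.
have [i vi] := row_neq0 v v0.
(* Translation by [x0] multiplies the character sum by [chi a], which is not 1. *)
pose x0 : 'rV[F]_n := (a / v 0 i) *: delta_mx 0 i.
have vx0 : dot v x0 = a.
  rewrite dotZr /dot (bigD1 i) //= big1 => [|j ji]; last first.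
    by rewrite mxE eqxx (negPf ji) mulr0.
  by rewrite mxE !eqxx mulr1 addr0 divfK.
set s := \sum_x _; have : chi a * s = s.
  rewrite {2}/s (reindex_inj (addrI x0)) mulr_sumr; apply: eq_bigr => x _.
  by rewrite dotDr vx0 add.
move/eqP; rewrite -subr_eq0 -{2}[s]mul1r -mulrBl mulf_eq0 subr_eq0.
by case/orP => /eqP.
Qed.

Lemma parseval n (h : 'rV[F]_n -> R[i]) :
  \sum_x normc (\sum_v h v * chi (dot v x)) ^+ 2 =
  (#|F| ^ n)%:R * \sum_v normc (h v) ^+ 2.
Proof.
have [_ add _] := hchi.
apply: complexI; rewrite rmorphM rmorph_nat !rmorph_sum /=.
have nE (z : R[i]) : ((normc z ^+ 2)%:C)%C = z * (z^*)%R.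
  by rewrite rmorphXn /= -normcE normCK.
under eq_bigr do rewrite nE.
under [in RHS]eq_bigr do rewrite nE.
have E x : (\sum_v h v * chi (dot v x)) * ((\sum_v h v * chi (dot v x))^*)%R =
    \sum_v \sum_w h v * ((h w)^*)%R * chi (dot (v - w) x).
  rewrite rmorph_sum mulr_suml; apply: eq_bigr => v _; rewrite mulr_sumr.
  apply: eq_bigr => w _; rewrite rmorphM /= character_conj dotDl dotNl add.
  by rewrite mulrACA.
under eq_bigr do rewrite E.
rewrite exchange_big mulr_sumr; apply: eq_bigr => v _ /=.
rewrite exchange_big /= (bigD1 v) //= [X in _ + X]big1 => [|w wv].
  by rewrite -mulr_sumr sum_character subrr eqxx addr0 mulrC.
by rewrite -mulr_sumr sum_character subr_eq0 eq_sym (negPf wv) mulr0.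
Qed.

End Fourier.

(** * Extension norms on the cone and the equality cases *)

Section Norms.

Context {R : realType} {F : finFieldType} {chi : F -> R[i]}.
Hypothesis odd_char : (2 : F) != 0.
Hypothesis hchi : nontrivial_additive_character chi.
Notation V := 'rV[F]_3.
Notation q := (#|F|%:R : R).
Notation s := (#|cone F|%:R : R).
Implicit Types (f : {xi | xi \in cone F} -> R[i]) (a b v : V).

(** Extension by zero to the whole space, where sums can be translated and convolved. *)
Definition extend0 f a : R[i] := if insub a is Some xi then f xi else 0.

Definition modulus f a : R := normc (extend0 f a).

Lemma extend0_val f xi : extend0 f (val xi) = f xi.
Proof. by rewrite /extend0 valK. Qed.

Lemma extend0_notin f a : a \notin cone F -> extend0 f a = 0.
Proof. by move=> aS; rewrite /extend0 insubN. Qed.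

Lemma modulus_val f xi : modulus f (val xi) = normc (f xi).
Proof. by rewrite /modulus extend0_val. Qed.

Lemma modulus_supp f a : a \notin cone F -> modulus f a = 0.
Proof. by move=> aS; rewrite /modulus extend0_notin // normc0. Qed.

Lemma normc_nneg (z : R[i]) : 0 <= normc z.
Proof. by rewrite -lecR -normcE normr_ge0. Qed.

Lemma modulus_ge0 f a : 0 <= modulus f a.
Proof. exact: normc_nneg. Qed.

Lemma normc_natV n : normc (n%:R^-1 : R[i]) = n%:R^-1.
Proof.
apply: complexI; rewrite -normcE normfV normr_nat.
by rewrite fmorphV rmorph_nat.
Qed.

Lemma sum_cone (T : zmodType) (h : V -> T) :
    (forall a, a \notin cone F -> h a = 0) ->
  \sum_(xi : {xi | xi \in cone F}) h (val xi) = \sum_a h a.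
Proof.
move=> h0; rewrite -(big_sub (cone F) h) big_mkcond; apply: eq_bigr => a _.
by case: ifP => // /negbT/h0.
Qed.

Lemma extensionE f x : extension chi f x =
  (#|cone F|%:R)^-1 * \sum_a extend0 f a * chi (dot a x).
Proof.
rewrite /extension; congr (_ * _).
rewrite -sum_cone => [|a aS]; last by rewrite extend0_notin // mul0r.
by apply: eq_bigr => xi _; rewrite extend0_val.
Qed.

Lemma L2norm4 f : L2norm f ^+ 4 = (s^-1 * total (modulus f)) ^+ 2.
Proof.
rewrite -[4%N]/(2 * 2)%N exprM sqr_sqrtr; last first.
  rewrite mulr_ge0 ?invr_ge0 ?ler0n // sumr_ge0 // => xi _; exact: sqr_ge0.
congr ((_ * _) ^+ 2); rewrite /total -sum_cone => [|a aS]; last first.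
  by rewrite modulus_supp // expr0n.
by apply: eq_bigr => xi _; rewrite modulus_val.
Qed.

Definition autoconv f v : R[i] := \sum_a extend0 f a * extend0 f (v - a).

(** Up to normalization, the square of the extension is the transform of the self-convolution;
    Parseval then applies to that square. *)
Lemma L4norm4 f : L4norm (extension chi f) ^+ 4 =
  q ^+ 3 / s ^+ 4 * \sum_v normc (autoconv f v) ^+ 2.
Proof.
have sum_ge0 : 0 <= \sum_(x : V) normc (extension chi f x) ^+ 4.
  by apply: sumr_ge0 => x _; rewrite exprn_ge0 ?normc_nneg.
rewrite /L4norm -powR_mulrn ?powR_ge0 // -powRrM mulVf ?pnatr_eq0 // powRr1 //.
have [_ add _] := hchi.
have E (x : V) : normc (extension chi f x) ^+ 4 =
    s^-1 ^+ 4 * normc (\sum_v autoconv f v * chi (dot v x)) ^+ 2.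
  rewrite extensionE normcM normc_natV exprMn; congr (_ * _).
  rewrite -[4%N]/(2 * 2)%N exprM; congr (_ ^+ 2).
  rewrite expr2 -normcM; congr normc.
  under [RHS]eq_bigr do rewrite mulr_suml.
  rewrite exchange_big mulr_suml; apply: eq_bigr => a _ /=.
  rewrite mulr_sumr [RHS](reindex_inj (addrI a)); apply: eq_bigr => b _ /=.
  by rewrite [a + b]addrC addrK dotDl add mulrACA [chi (dot a x) * _]mulrC.
under eq_bigr do rewrite E.
by rewrite -mulr_sumr (parseval hchi) natrX exprVn mulrA [_^-1 * _]mulrC.
Qed.

Lemma energy_conv (g : V -> R) :
  energy g = \sum_v (\sum_a g a * g (v - a)) ^+ 2.
Proof.
rewrite /energy sum_tripleE.
under [RHS]eq_bigr do rewrite expr2 mulr_suml.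
rewrite [RHS]exchange_big; apply: eq_bigr => a _ /=.
rewrite [RHS](reindex_inj (addrI a)); apply: eq_bigr => b _ /=.
rewrite mulr_sumr; apply: eq_bigr => c _.
by rewrite /quad /= [a + b - a]addrAC subrr add0r.
Qed.

Lemma autoconv_le f v :
  normc (autoconv f v) <= \sum_a modulus f a * modulus f (v - a).
Proof.
rewrite -lecR -normcE rmorph_sum /=; apply: le_trans (ler_norm_sum _ _ _) _.
by apply: ler_sum => a _; rewrite normrM rmorphM /= -!normcE.
Qed.

Lemma dual_factor_gt0 : 0 < q ^+ 3 / s ^+ 4.
Proof.
rewrite divr_gt0 ?exprn_gt0 // ltr0n ?card_gt0 ?cone_neq_set0 //.
by apply/card_gt0P; exists 0.
Qed.

Lemma cone_constantE f : cone_constant R F * L2norm f ^+ 4 = q ^+ 3 / s ^+ 4 *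
  ((q + 1 - (3 * q - 4) / s) * total (modulus f) ^+ 2).
Proof.
have s0 : s != 0 by rewrite pnatr_eq0 cards_eq0 cone_neq_set0.
by rewrite L2norm4 /cone_constant; field.
Qed.

Lemma L4norm_energy f :
  L4norm (extension chi f) ^+ 4 <= q ^+ 3 / s ^+ 4 * energy (modulus f).
Proof.
rewrite L4norm4 ler_pM2l ?dual_factor_gt0 // energy_conv; apply: ler_sum => v _.
by rewrite ler_sqr ?nnegrE ?normc_nneg ?autoconv_le ?sumr_ge0 // => a _;
  rewrite mulr_ge0 ?modulus_ge0.
Qed.

Lemma extension_le f :
  L4norm (extension chi f) ^+ 4 <= cone_constant R F * L2norm f ^+ 4.
Proof.
apply: le_trans (L4norm_energy f) _; rewrite cone_constantE ler_pM2l ?dual_factor_gt0 //.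
apply: energy_le => //; [exact: modulus_supp|exact: modulus_ge0].
Qed.

(** For constant [z] all terms of the convolution at [v] equal [z * z], so the triangle inequality
    loses nothing; the constant modulus attains the energy bound. *)
Lemma extension_const f (z : R[i]) : (forall xi, f xi = z) ->
  L4norm (extension chi f) ^+ 4 = cone_constant R F * L2norm f ^+ 4.
Proof.
move=> fz; have fE a : extend0 f a = if a \in cone F then z else 0.
  case: ifP => [aS|/negbT/extend0_notin//].
  by rewrite -[a]/(val (exist (fun xi => xi \in cone F) a aS)) extend0_val.
have gE a : modulus f a = if a \in cone F then normc z else 0.
  by rewrite /modulus fE; case: ifP => // _; rewrite normc0.
have cst : const_on_cone (modulus f) by move=> a b aS bS; rewrite !gE aS bS.
rewrite cone_constantE -(energy_const odd_char _ (modulus_supp f) cst).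
rewrite L4norm4 energy_conv; congr (_ * _); apply: eq_bigr => v _.
pose r : V -> bool := fun a => (a \in cone F) && (v - a \in cone F).
congr (_ ^+ 2); transitivity (normc (z * z *+ #|r|)).
  congr normc; rewrite /autoconv -sumr_const [RHS]big_mkcond; apply: eq_bigr => a _.
  rewrite !fE unfold_in /r.
  by case: (a \in cone F); case: (v - a \in cone F); rewrite ?mul0r ?mulr0.
have nn : normc (#|r|%:R : R[i]) = #|r|%:R.
  by apply: complexI; rewrite -normcE normr_nat rmorph_nat.
rewrite -mulr_natl normcM nn normcM mulr_natl.
rewrite -sumr_const [LHS]big_mkcond; apply: eq_bigr => a _; rewrite !gE unfold_in /r.
by case: (a \in cone F); case: (v - a \in cone F); rewrite ?mul0r ?mulr0.
Qed.

(** The energy of the modulus lies between the fourth power of the [L4norm] and the bound; for a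
    maximizer these agree after scaling, and [energy_max] applies. *)
Lemma maximizer_const_modulus f : maximizer chi f ->
  forall xi eta, normc (f xi) = normc (f eta).
Proof.
move=> [_ E] xi eta; rewrite -!modulus_val.
have supp := @modulus_supp f; have ge0 := @modulus_ge0 f.
apply: (energy_max odd_char _ supp ge0 _ _ _ (valP xi) (valP eta)).
apply: le_anti; rewrite (energy_le odd_char _ supp ge0) /=.
rewrite -(ler_pM2l dual_factor_gt0) -cone_constantE -E; exact: L4norm_energy.
Qed.

End Norms.

Theorem corollary1p6 (R : realType) (F : finFieldType) (chi : F -> R[i])
    (oddF : 2%N \notin [pchar F]) (hchi : nontrivial_additive_character chi) :
  [/\ (forall f : {xi | xi \in cone F} -> R[i],
         L4norm (extension chi f) ^+ 4 <= cone_constant R F * L2norm f ^+ 4),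
      (forall C : R,
         (forall f : {xi | xi \in cone F} -> R[i],
            L4norm (extension chi f) ^+ 4 <= C * L2norm f ^+ 4) ->
         cone_constant R F <= C),
      (forall (f : {xi | xi \in cone F} -> R[i]) (c : R[i]),
         (forall xi, f xi = c) ->
         L4norm (extension chi f) ^+ 4 = cone_constant R F * L2norm f ^+ 4)
    & (forall f : {xi | xi \in cone F} -> R[i],
         maximizer chi f -> forall xi eta, normc (f xi) = normc (f eta))].
Proof.
have odd2 : (2 : F) != 0 by move: oddF; rewrite inE.
split.
- by move=> f; apply: extension_le.
(* The constant function 1 attains the bound, and its [L2norm] is positive because the cone is
   nonempty, so it can be cancelled. *)
- move=> C HC; pose f1 : {xi | xi \in cone F} -> R[i] := fun=> 1.
  have := HC f1; rewrite (extension_const odd2 hchi _ 1) //.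
  rewrite ler_pM2r // L2norm4 exprn_gt0 // mulr_gt0 //.
    by rewrite invr_gt0 ltr0n card_gt0 cone_neq_set0.
  have [a aS] := cone_nonempty odd2.
  rewrite lt_neqAle eq_sym; apply/andP; split; last first.
    by apply: sumr_ge0 => b _; rewrite sqr_ge0.
  rewrite psumr_neq0 => [|b _]; last exact: sqr_ge0.
  apply/hasP; exists a; rewrite ?mem_index_enum //=.
  rewrite -[a]/(val (exist (fun xi => xi \in cone F) a aS)) modulus_val /f1.
  by rewrite normc1 expr1n ltr01.
- by move=> f c fc; apply: extension_const fc.
by move=> f; apply: maximizer_const_modulus.
Qed.
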